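(* Let $\alpha^1,\beta^1,\alpha^2,\gamma^2,\beta^3,\gamma^3,\omega$ be seven mutually distinct colors and let $$\Phi_3=\{(\alpha^1,\beta^1,\omega),(\alpha^2,\omega,\gamma^2),(\omega,\beta^3,\gamma^3)\}.$$ Let $\alpha,\beta,\gamma$ be three mutually distinct colors and let $$\Phi_8=\{(x,y,z) : x\in\{\beta,\gamma\},\ y\in\{\alpha,\gamma\},\ z\in\{\alpha,\beta\}\}.$$ Let $n$ and $m$ be non-negative integers such that $n!<(10/9)^m$, and suppose that there exists a $5$-uniform linear hypergraph with exactly $n$ vertices and exactly $m$ edges. Then there exists a $3$-uniform hypergraph with exactly $n$ vertices and exactly $3m$ edges that is $\Phi_3$-colorable but not $\Phi_8$-colorable.
   Context: All hypergraphs are finite; a $k$-uniform hypergraph consists of a finite vertex set together with a set of $k$-element subsets of it, called edges. A hypergraph is linear if any two distinct edges have at most one vertex in common. Palettes and colorability: a palette is a (finite) set of ordered triples of colors. For a palette $\Phi$, an $n$-vertex $3$-uniform hypergraph $H$ is $\Phi$-colorable if there exist an ordering $v_1,\ldots,v_n$ of the vertices of $H$ and a coloring of the (unordered) pairs of vertices of $H$ with colors appearing in triples of $\Phi$, where $c_{ij}$ denotes the color of the pair $\{v_i,v_j\}$ for $i<j$, such that whenever $1\le i<j<k\le n$ and $\{v_i,v_j,v_k\}$ is an edge of $H$, the triple $(c_{ij},c_{jk},c_{ik})$ belongs to $\Phi$ (note the order of the entries: the pair $\{v_i,v_k\}$ comes last). *)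

(* Defs.v *)
From mathcomp Require Import all_boot all_order all_algebra.
From mathcomp Require Import finmap.

Set Implicit Arguments.
Unset Strict Implicit.
Unset Printing Implicit Defensive.

Local Open Scope fset_scope.

Record hypergraph := Hypergraph {
  vertex : finType;
  edges : {set {set vertex}}
}.

Definition uniform (k : nat) (H : hypergraph) : Prop :=
  forall e : {set vertex H}, e \in edges H -> #|e| = k.

Definition linear_hypergraph (H : hypergraph) : Prop :=
  forall e f : {set vertex H},
    e \in edges H -> f \in edges H -> e <> f -> #|e :&: f| <= 1.

Definition palette (C : choiceType) := {fset C * C * C}.

Definition palette_colors (C : choiceType) (Phi : palette C) : {fset C} :=
  [fset t.1.1 | t in Phi] `|` [fset t.1.2 | t in Phi] `|` [fset t.2 | t in Phi].

(* The ordering is a bijection from the positions 0, ..., n - 1 to the vertices.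
   A coloring of the pairs is a function on all vertex sets, of which only the
   values on the two-element sets matter. *)
Definition colorable (C : choiceType) (Phi : palette C) (H : hypergraph) : Prop :=
  exists v : 'I_#|vertex H| -> vertex H,
  exists c : {set vertex H} -> C,
    [/\ bijective v,
        forall p : {set vertex H}, #|p| = 2 -> c p \in palette_colors Phi
      & forall i j k : 'I_#|vertex H|, i < j -> j < k ->
          [set v i; v j; v k] \in edges H ->
          (c [set v i; v j], c [set v j; v k], c [set v i; v k]) \in Phi].

Definition Phi3 (C : choiceType) (a1 b1 a2 g2 b3 g3 w : C) : palette C :=
  [fset (a1, b1, w); (a2, w, g2); (w, b3, g3)].

Definition Phi8 (C : choiceType) (a b g : C) : palette C :=
  [fset b; g] `*` [fset a; g] `*` [fset a; b].

(* Main.v *)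
(* In every edge e of the 5-uniform hypergraph choose a pair f e, and let H
   consist of the three triples x |: f e with x in e :\: f e.  By linearity
   distinct e share no pair, so whatever the choice and the ordering, giving
   f e the color w lets every triple use one of the three patterns of Phi3.
   A Phi8-coloring with a given ordering forbids one color for each of the three
   roles of a pair in a triple, so it cannot exist if f e consists of the second
   and fourth vertices of some e.  One choice of f e out of 10 does this, so by
   the union bound n! 9^m < 10^m yields a choice that defeats all orderings. *)
Require Import Defs.
From mathcomp Require Import all_boot all_order all_algebra.
From mathcomp Require Import finmap.

Set Implicit Arguments.
Unset Strict Implicit.
Unset Printing Implicit Defensive.

Import GRing.Theory Num.Theory.

(** * A union bound over choice functions *)

Lemma card_pfamily_const (aT rT : finType) (y0 : rT) (D : {set aT})
    (F : aT -> {set rT}) (k : nat) :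
  (forall x, x \in D -> #|F x| = k) -> #|pfamily y0 D F| = k ^ #|D|.
Proof.
move=> Fk; rewrite card_pfamily /image_mem cardE.
have: {subset enum D <= D} by move=> x; rewrite mem_enum.
elim: (enum D) => [|x s IHs] sD //=.
rewrite expnS IHs => [|y ys]; last by apply: sD; rewrite inE ys orbT.
by rewrite Fk // sD ?mem_head.
Qed.

(** For each [t], at most [k ^ #|D|] of the [k.+1 ^ #|D|] admissible choices fail to hit [t]. Summed
    over [S], the failures cannot exhaust all choices, so some choice hits every [t] at once. *)
Lemma hitting_choice (T aT rT : finType) (y0 : rT) (S : {set T}) (D : {set aT})
    (F : aT -> {set rT}) (R : T -> aT -> pred rT) (k : nat) :
  (forall x, x \in D -> #|F x| = k.+1) ->
  (forall t x, t \in S -> x \in D -> exists2 y, y \in F x & R t x y) ->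
  #|S| * k ^ #|D| < k.+1 ^ #|D| ->
  exists2 f : aT -> rT, (forall x, x \in D -> f x \in F x) &
    forall t, t \in S -> exists2 x, x \in D & R t x (f x).
Proof.
move=> Fk exR ltS.
pose r t x := odflt y0 [pick y in F x | R t x y].
have rP t x : t \in S -> x \in D -> r t x \in F x /\ R t x (r t x).
  move=> tS xD; rewrite /r; case: pickP => [y /andP[] //|none].
  by have [y yF yR] := exR t x tS xD; have:= none y; rewrite /= yF yR.
(* [miss t] holds the choices that avoid the fixed value everywhere, hence every admissible choice
   that fails to hit [t]. Each point keeps exactly [k] values. *)
pose miss t := [set f in pfamily y0 D (fun x => F x :\ r t x)].
have card_miss t : t \in S -> #|miss t| = k ^ #|D|.
  move=> tS; rewrite cardsE; apply: card_pfamily_const => x xD.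
  have [rF _] := rP t x tS xD.
  by have := cardsD1 (r t x) (F x); rewrite rF Fk // => -[].
have lt_union : #|\bigcup_(t in S) miss t| < #|[set f in pfamily y0 D F]|.
  rewrite cardsE (card_pfamily_const _ Fk); apply: leq_ltn_trans ltS.
  rewrite -sum_nat_const -(eq_bigr _ card_miss).
  elim/big_rec2: _ => [|t N A tS leAN]; first by rewrite cards0.
  by rewrite (leq_trans (leq_card_setU _ _).1) // leq_add2l.
have /subsetPn[f fF fU] : ~~ ([set f in pfamily y0 D F] \subset
    \bigcup_(t in S) miss t).
  by apply/negP => /subset_leq_card; rewrite leqNgt lt_union.
move: fF; rewrite inE => /pfamilyP[fD fF].
exists f => [//|t tS].
have [/exists_inP //|noR] := boolP [exists x in D, R t x (f x)].
case/negP: fU; apply/bigcupP; exists t => //; rewrite inE.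
apply/pfamilyP; split=> // x xD; rewrite !inE fF // andbT.
apply: contra noR => /eqP fx; apply/exists_inP; exists x => //.
by rewrite fx; have [] := rP t x tS xD.
Qed.

(** * Second and fourth vertices of an edge in an ordering *)

Lemma enum5_sorted (N : nat) (A : {set 'I_N}) : #|A| = 5 ->
  exists i0 i1 i2 i3 i4 : 'I_N,
    [/\ [/\ i0 < i1, i1 < i2, i2 < i3 & i3 < i4]
      & enum A = [:: i0; i1; i2; i3; i4]].
Proof.
move=> A5; have: sorted (fun i j : 'I_N => i < j) (enum A).
  (* [enum A] filters the increasing enumeration of all ordinals and inherits its order. *)
  rewrite {1}/enum_mem; apply: sorted_filter.
    by move=> ? ? ?; apply: ltn_trans.
  by rewrite -enumT -(@sorted_map _ _ val ltn) val_enum_ord iota_ltn_sorted.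
move: A5; rewrite cardE.
case: (enum A) => [|i0 [|i1 [|i2 [|i3 [|i4 [|? ?]]]]]] //= _.
by case/and5P=> ? ? ? ? _; exists i0, i1, i2, i3, i4.
Qed.

(* When #|e| = 5, the i's list e, so p consists of its second and fourth
   vertices in the ordering v. *)
Definition alternate_pair (N : nat) (T : finType) (v : 'I_N -> T)
    (e p : {set T}) : bool :=
  [exists i0 : 'I_N, exists i1 : 'I_N, exists i2 : 'I_N, exists i3 : 'I_N,
   exists i4 : 'I_N,
    [&& i0 < i1, i1 < i2, i2 < i3, i3 < i4, p == [set v i1; v i3]
      & [&& v i0 \in e, v i1 \in e, v i2 \in e, v i3 \in e & v i4 \in e]]].

Lemma alternate_pairP (N : nat) (T : finType) (v : 'I_N -> T)
    (e p : {set T}) :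
  reflect (exists i0 i1 i2 i3 i4 : 'I_N,
     [/\ [/\ i0 < i1, i1 < i2, i2 < i3 & i3 < i4], p = [set v i1; v i3]
       & [/\ v i0 \in e, v i1 \in e, v i2 \in e, v i3 \in e & v i4 \in e]])
   (alternate_pair v e p).
Proof.
apply: (iffP existsP) => [[i0 /existsP[i1 /existsP[i2 /existsP[i3 /existsP[i4]]]]]|].
  case/and5P=> ? ? ? ? /andP[/eqP ? /and5P[? ? ? ? ?]].
  by exists i0, i1, i2, i3, i4.
case=> i0 [i1 [i2 [i3 [i4 [[lt01 lt12 lt23 lt34] -> [e0 e1 e2 e3 e4]]]]]].
exists i0; apply/existsP; exists i1; apply/existsP; exists i2.
apply/existsP; exists i3; apply/existsP; exists i4.
by rewrite lt01 lt12 lt23 lt34 eqxx e0 e1 e2 e3 e4.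
Qed.

Lemma exists_alternate_pair (N : nat) (T : finType) (v : 'I_N -> T)
    (e : {set T}) : bijective v -> #|e| = 5 ->
  exists2 p : {set T}, p \in [set p : {set T} | p \subset e & #|p| == 2]
    & alternate_pair v e p.
Proof.
move=> bijv e5; have injv := bij_inj bijv.
have [|i0 [i1 [i2 [i3 [i4 [[lt01 lt12 lt23 lt34] eA]]]]]] :=
  @enum5_sorted _ (v @^-1: e).
  by rewrite on_card_preimset //; apply: onW_bij.
have mem_e i : i \in [:: i0; i1; i2; i3; i4] -> v i \in e.
  by rewrite -eA mem_enum inE.
have [e0 e1 e2 e3 e4] : [/\ v i0 \in e, v i1 \in e, v i2 \in e, v i3 \in e
    & v i4 \in e] by split; apply: mem_e; rewrite !inE eqxx ?orbT.
exists [set v i1; v i3].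
  rewrite inE subUset !sub1set e1 e3 cards2 (inj_eq injv) -val_eqE.
  by rewrite neq_ltn (ltn_trans lt12 lt23).
by apply/alternate_pairP; exists i0, i1, i2, i3, i4.
Qed.

(** * The triples extending a chosen pair in each edge *)

Section PairExtension.

Variables (T : finType) (E : {set {set T}}) (f : {set T} -> {set T}).

Definition pair_extension : {set {set T}} :=
  \bigcup_(e in E) [set x |: f e | x in e :\: f e].

Lemma pair_extensionP (q : {set T}) :
  reflect (exists e x, [/\ e \in E, x \in e, x \notin f e & q = x |: f e])
    (q \in pair_extension).
Proof.
apply: (iffP bigcupP) => [[e eE /imsetP[x]]|[e [x [eE xe xf ->]]]].
  by rewrite inE => /andP[xf xe] ->; exists e, x.
by exists e => //; apply: imset_f; rewrite inE xf.
Qed.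

Hypothesis E5 : forall e, e \in E -> #|e| = 5.
Hypothesis E_linear : linear_hypergraph (Hypergraph E).
Hypothesis f_pair : forall e, e \in E -> f e \subset e /\ #|f e| = 2.

Lemma pair_edge_inj (p e e' : {set T}) : #|p| = 2 -> e \in E -> e' \in E ->
  p \subset e -> p \subset e' -> e = e'.
Proof.
move=> p2 eE e'E pe pe'; case: (eqVneq e e') => // /eqP ne.
have := E_linear eE e'E ne; rewrite leqNgt => /negP[].
by rewrite -p2 subset_leq_card // subsetI pe.
Qed.

Lemma extension_sub (e : {set T}) (x : T) :
  e \in E -> x \in e -> x |: f e \subset e.
Proof. by move=> eE xe; rewrite subUset sub1set xe (f_pair eE).1. Qed.

Lemma uniform_pair_extension : uniform 3 (Hypergraph pair_extension).
Proof.
move=> q /pair_extensionP[e [x [eE _ xf ->]]].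
by rewrite cardsU1 xf (f_pair eE).2.
Qed.

(** Each [e] contributes 5 - 2 = 3 triples. None is counted twice: by linearity the pair [f e]
    inside a triple determines [e], and then [x] is the only point of the triple outside [f e]. *)
Lemma card_pair_extension : #|pair_extension| = 3 * #|E|.
Proof.
pose Q := [set u : {set T} * T | u.1 \in E & u.2 \in u.1 :\: f u.1].
have -> : pair_extension = [set u.2 |: f u.1 | u in Q].
  apply/setP=> q; apply/pair_extensionP/imsetP.
    by case=> e [x [eE xe xf ->]]; exists (e, x); rewrite // !inE eE xf xe.
  by case=> -[e x]; rewrite !inE /= => /and3P[eE xf xe] ->; exists e, x.
rewrite card_in_imset; last first.
  move=> [e x] [e' x']; rewrite !inE /= => /and3P[eE xf xe] /and3P[e'E x'f x'e].
  move=> eq_ext; have eqe : e = e'.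
    apply: (pair_edge_inj (f_pair eE).2) => //; first exact: (f_pair eE).1.
    apply: subset_trans (extension_sub e'E x'e).
    by rewrite -eq_ext subsetUr.
  subst e'; have := setU11 x (f e); rewrite eq_ext !inE (negPf xf) orbF.
  by move/eqP->.
rewrite -sum1_card; under eq_bigl do rewrite inE.
rewrite -(pair_big_dep (mem E) (fun e x => x \in e :\: f e) (fun _ _ => 1)) /=.
under eq_bigr => e eE.
  rewrite sum1_card cardsD (setIidPr (f_pair eE).1) (f_pair eE).2 E5 //.
  over.
by rewrite sum_nat_const mulnC.
Qed.

Lemma ext_contains_chosen (q : {set T}) : q \in pair_extension ->
  exists2 p, p \in f @: E & p \subset q.
Proof.
case/pair_extensionP=> e [x [eE _ _ ->]].
by exists (f e); [apply: imset_f | apply: subsetUr].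
Qed.

(** A triple built from [e] lies in [e], so a chosen pair [f e'] inside it lies in both [e] and
    [e'], and linearity gives [e' = e]. *)
Lemma chosen_pair_uniq (q p p' : {set T}) : q \in pair_extension ->
  p \in f @: E -> p' \in f @: E -> p \subset q -> p' \subset q -> p = p'.
Proof.
case/pair_extensionP=> e [x [eE xe _ ->]].
case/imsetP=> e1 e1E -> /imsetP[e2 e2E ->] sub1 sub2.
have inE' e' : e' \in E -> f e' \subset x |: f e -> e' = e.
  move=> e'E sub; apply: (pair_edge_inj (f_pair e'E).2) => //.
    exact: (f_pair e'E).1.
  exact: subset_trans sub (extension_sub eE xe).
by rewrite (inE' e1) // (inE' e2).
Qed.

Lemma unchosen_pair_uniq (p q q' : {set T}) : #|p| = 2 -> p \notin f @: E ->
  q \in pair_extension -> q' \in pair_extension ->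
  p \subset q -> p \subset q' -> q = q'.
Proof.
move=> p2 pf /pair_extensionP[e [x [eE xe xf ->]]].
case/pair_extensionP=> e' [x' [e'E x'e' x'f ->]] pq pq'.
have eqe : e = e'.
  apply: (pair_edge_inj p2) => //.
    exact: subset_trans pq (extension_sub eE xe).
  exact: subset_trans pq' (extension_sub e'E x'e').
subst e'.
(* A pair inside [y |: f e] that avoids [y] would be [f e] itself, which is chosen. So an unchosen
   pair contains the added vertex of its triple, and that vertex is thereby determined. *)
have apex y : p \subset y |: f e -> y \in p.
  move=> py; apply: contraNT pf => yp; apply/imsetP; exists e => //.
  apply/eqP; rewrite eqEcard p2 (f_pair eE).2 leqnn andbT.
  apply/subsetP=> z zp; have := subsetP py z zp.
  by rewrite !inE => /orP[/eqP zy|//]; rewrite -zy zp in yp.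
have := subsetP pq' x (apex x pq).
by rewrite !inE (negPf xf) orbF => /eqP->.
Qed.

End PairExtension.

(** * Coloring with [Phi3] *)

Lemma mem_Phi3 (C : choiceType) (a1 b1 a2 g2 b3 g3 w : C) (t : C * C * C) :
  (t \in Phi3 a1 b1 a2 g2 b3 g3 w) =
  [|| t == (a1, b1, w), t == (a2, w, g2) | t == (w, b3, g3)].
Proof. by rewrite !inE orbA. Qed.

Lemma mem_palette_colors (C : choiceType) (Phi : palette C) (x y z : C) :
  (x, y, z) \in Phi ->
  [/\ x \in palette_colors Phi, y \in palette_colors Phi
    & z \in palette_colors Phi].
Proof.
move=> t; split; rewrite !in_fsetU.
- by apply/orP; left; apply/orP; left; apply/imfsetP; exists (x, y, z).
- by apply/orP; left; apply/orP; right; apply/imfsetP; exists (x, y, z).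
- by apply/orP; right; apply/imfsetP; exists (x, y, z).
Qed.

(* Pairs in S get color w; any other pair lies in at most one edge and gets the
   color that its role there requires. *)
Lemma Phi3_colorable (C : choiceType) (a1 b1 a2 g2 b3 g3 w : C)
    (H : hypergraph) (S : {set {set vertex H}}) :
  (forall q, q \in edges H -> exists2 p, p \in S & p \subset q) ->
  (forall p, p \in S -> #|p| = 2) ->
  (forall q p p' : {set vertex H}, q \in edges H -> p \in S -> p' \in S ->
     p \subset q -> p' \subset q -> p = p') ->
  (forall p q q' : {set vertex H}, #|p| = 2 -> p \notin S ->
     q \in edges H -> q' \in edges H -> p \subset q -> p \subset q' -> q = q') ->
  colorable (Phi3 a1 b1 a2 g2 b3 g3 w) H.
Proof.
move=> S_ex S2 S_uniq notS_uniq; set Phi := Phi3 _ _ _ _ _ _ _.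
pose N := #|vertex H|.
pose v : 'I_N -> vertex H := @enum_val _ (mem (vertex H)).
have bijv : bijective v by apply: enum_val_bij.
have injv := bij_inj bijv.
pose q3 (t : 'I_N * 'I_N * 'I_N) := [set v t.1.1; v t.1.2; v t.2].
pose P (p : {set vertex H}) (t : 'I_N * 'I_N * 'I_N) :=
  [&& t.1.1 < t.1.2, t.1.2 < t.2, q3 t \in edges H & p \subset q3 t].
(* The vertex of the edge that [p] misses gives the role of [p]: missing [v k], [v i] or [v j] makes
   it the first, second or third entry. The tests in [S] then locate the chosen pair of the edge and
   so select the pattern. The final [w] is a default for sets outside [S] that no edge contains. *)
pose c (p : {set vertex H}) := if p \in S then w else
  if [pick t | P p t] is Some (i, j, k) then
    if v k \notin p then (if [set v j; v k] \in S then a2 else a1)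
    else if v i \notin p then (if [set v i; v j] \in S then b3 else b1)
    else (if [set v i; v j] \in S then g3 else g2)
  else w.
have PhiE := mem_Phi3 a1 b1 a2 g2 b3 g3 w.
have [c1 c2 c3] : [/\ a1 \in palette_colors Phi, b1 \in palette_colors Phi
    & w \in palette_colors Phi].
  by apply: mem_palette_colors; rewrite PhiE eqxx.
have [c4 _ c5] : [/\ a2 \in palette_colors Phi, w \in palette_colors Phi
    & g2 \in palette_colors Phi].
  by apply: mem_palette_colors; rewrite PhiE eqxx orbT.
have [_ c6 c7] : [/\ w \in palette_colors Phi, b3 \in palette_colors Phi
    & g3 \in palette_colors Phi].
  by apply: mem_palette_colors; rewrite PhiE eqxx !orbT.
exists v, c; split=> // [p _|i j k lt_ij lt_jk qH].
  rewrite /c; case: (p \in S) => //.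
  by case: pickP => [[[i j] k] _|_] //; do 3?case: ifP.
have lt_ik := ltn_trans lt_ij lt_jk.
have [ij jk ik] : [/\ (i == j) = false, (j == k) = false & (i == k) = false].
  by rewrite -!val_eqE !ltn_eqF.
(* An unchosen pair lies in only one edge, and an edge has only one increasing listing, so [pick]
   must return this very triple. *)
have cP (p : {set vertex H}) : #|p| = 2 -> p \notin S -> p \subset q3 (i, j, k) ->
    [pick t | P p t] = Some (i, j, k).
  move=> p2 pS pq; case: pickP => [[[i' j'] k'] /and4P[/= lt1 lt2 q'H pq']|].
    have eqq : q3 (i', j', k') = q3 (i, j, k) by apply: (notS_uniq p).
    have [] // : [:: i'; j'; k'] = [:: i; j; k]; last by move=> -> -> ->.
    apply: (@irr_sorted_eq _ (fun x y : 'I_N => x < y)).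
    - by move=> ? ? ?; apply: ltn_trans.
    - by move=> ?; apply: ltnn.
    - by rewrite /= lt1 lt2.
    - by rewrite /= lt_ij lt_jk.
    move=> x; have /setP/(_ (v x)) := eqq.
    by rewrite !inE !(inj_eq injv) !orbA.
  by move/(_ (i, j, k)); rewrite /P /= lt_ij lt_jk qH pq.
have [sub_ij sub_jk sub_ik] : [/\ [set v i; v j] \subset q3 (i, j, k),
    [set v j; v k] \subset q3 (i, j, k) & [set v i; v k] \subset q3 (i, j, k)].
  by split; apply/subsetP=> z; rewrite !inE => /orP[] ->; rewrite ?orbT.
have [card_ij card_jk card_ik] : [/\ #|[set v i; v j]| = 2,
    #|[set v j; v k]| = 2 & #|[set v i; v k]| = 2].
  by rewrite !cards2 !(inj_eq injv) ij jk ik.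
have neq_ij_jk : [set v i; v j] <> [set v j; v k].
  by move/setP/(_ (v i)); rewrite !inE !(inj_eq injv) eqxx ij ik.
have neq_ij_ik : [set v i; v j] <> [set v i; v k].
  by move/setP/(_ (v j)); rewrite !inE !(inj_eq injv) eqxx orbT (eq_sym j i) ij jk.
have neq_jk_ik : [set v j; v k] <> [set v i; v k].
  by move/setP/(_ (v j)); rewrite !inE !(inj_eq injv) eqxx (eq_sym j i) ij jk.
have excl (p p' : {set vertex H}) : p \in S ->
    p \subset q3 (i, j, k) -> p' \subset q3 (i, j, k) -> p <> p' ->
    (p' \in S) = false.
  by move=> pS pq p'q ne; apply/negP => p'S; apply/ne/(S_uniq (q3 (i, j, k))).
have one_chosen : [|| [set v i; v j] \in S, [set v j; v k] \in S
    | [set v i; v k] \in S].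
  have [p pS pq] := S_ex _ qH.
  have /eqP/cards2P[x [y [xy def_p]]] := S2 _ pS.
  move: pq; rewrite {}def_p in pS *; rewrite subUset !sub1set !inE -!orbA.
  (* Of the nine placements of [x] and [y], three contradict [x != y], and the reversed ones reduce
     to the others by symmetry of the pair. *)
  case/andP=> /or3P[]/eqP ex /or3P[]/eqP ey; rewrite {}ex {}ey in pS xy *;
    rewrite ?eqxx // in xy; rewrite ?pS ?orbT //;
    by rewrite setUC in pS; rewrite pS ?orbT.
rewrite PhiE; case/or3P: one_chosen => chosen.
- rewrite /c chosen.
  have njk := excl _ _ chosen sub_ij sub_jk neq_ij_jk.
  have nik := excl _ _ chosen sub_ij sub_ik neq_ij_ik.
  rewrite njk nik !cP ?njk ?nik //.
  by rewrite !inE !(inj_eq injv) !eqxx ij ik ?orbT /= chosen eqxx !orbT.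
- rewrite /c chosen.
  have nij := excl _ _ chosen sub_jk sub_ij (nesym neq_ij_jk).
  have nik := excl _ _ chosen sub_jk sub_ik neq_jk_ik.
  rewrite nij nik !cP ?nij ?nik // !inE !(inj_eq injv) !eqxx.
  by rewrite 2!(eq_sym k) ik jk /= chosen eqxx orbT.
- rewrite /c chosen.
  have nij := excl _ _ chosen sub_ik sub_ij (nesym neq_ij_ik).
  have njk := excl _ _ chosen sub_ik sub_jk (nesym neq_jk_ik).
  rewrite nij njk !cP ?nij ?njk // !inE !(inj_eq injv) !eqxx.
  by rewrite 2!(eq_sym k) ik jk ij /= eqxx.
Qed.

(** * The obstruction to [Phi8], and the conclusion *)

(** The three roles confine [c] to {b, g}, {a, g} and {a, b}, which have no common element. *)
Lemma Phi8_not_all_roles (D : choiceType) (a b g : D) (x y z t r s c : D) :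
  uniq [:: a; b; g] ->
  (c, x, y) \in Phi8 a b g -> (z, c, t) \in Phi8 a b g ->
  (r, s, c) \in Phi8 a b g -> False.
Proof.
rewrite /= !inE /= => /and3P[/norP[ab ag] bg _].
move=> /andP[/andP[c1 _] _] /andP[/andP[_ c2] _] /andP[_ c3].
case/orP: c1 c2 c3 => /eqP->.
  by rewrite (eq_sym b) (negPf ab) (negPf bg).
by rewrite !(eq_sym g) (negPf ag) (negPf bg).
Qed.

Theorem proposition11
  (C : choiceType) (a1 b1 a2 g2 b3 g3 w : C)
  (C_uniq : uniq [:: a1; b1; a2; g2; b3; g3; w])
  (D : choiceType) (a b g : D)
  (D_uniq : uniq [:: a; b; g])
  (n m : nat)
  (n_lt : (n`!%:R < (10%:R / 9%:R) ^+ m :> rat)%R)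
  (exG : exists G : hypergraph,
    [/\ uniform 5 G, linear_hypergraph G, #|vertex G| = n & #|edges G| = m]) :
  exists H : hypergraph,
    [/\ uniform 3 H, #|vertex H| = n, #|edges H| = 3 * m,
        colorable (Phi3 a1 b1 a2 g2 b3 g3 w) H
      & ~ colorable (Phi8 a b g) H].
Proof.
case: exG => -[V E] /= [E5 E_linear cardV cardE].
have ltn : n`! * 9 ^ m < 10 ^ m.
  rewrite -(ltr_nat rat) natrM !natrX -ltr_pdivlMr ?exprn_gt0 ?ltr0n //.
  by rewrite -expr_div_n.
(* Orderings are encoded as injective finite functions, so that they form a finite set that can be
   counted. *)
pose S := [set t : {ffun 'I_#|V| -> V} | injectiveb t].
have cardS : #|S| = n`! by rewrite card_inj_ffuns card_ord ffactnn cardV.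
have S_bij t : t \in S -> bijective t.
  rewrite inE => /injectiveP injt; apply: inj_card_bij => //.
  by rewrite card_ord.
(* There are 10 pairs in a 5-set, so the union bound applies with [k] equal to 9. *)
have draws5 e : e \in E ->
    #|[set p : {set V} | p \subset e & #|p| == 2]| = 10.
  by move=> eE; rewrite cards_draws E5.
have [] := hitting_choice set0 draws5 (S := S) (R := fun t => alternate_pair t).
- by move=> t e /S_bij bijt /E5; apply: exists_alternate_pair.
- by rewrite cardS cardE.
move=> f f_draw f_hit.
have f_pair e : e \in E -> f e \subset e /\ #|f e| = 2.
  by move/f_draw; rewrite inE => /andP[-> /eqP].
exists (Hypergraph (pair_extension E f)); split=> //.
- exact: uniform_pair_extension.
- by rewrite /= card_pair_extension // cardE.
- apply: (@Phi3_colorable _ _ _ _ _ _ _ _ (Hypergraph _) (f @: E)).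
  + exact: ext_contains_chosen.
  + by move=> p /imsetP[e /f_pair[_ f2] ->].
  + exact: chosen_pair_uniq.
  + exact: unchosen_pair_uniq.
case=> v [c [bijv _ cPhi]].
have [|e eE] := f_hit (finfun v).
  by rewrite inE; apply/injectiveP => x y; rewrite !ffunE; apply: bij_inj.
move=> /alternate_pairP[i0 [i1 [i2 [i3 [i4]]]]].
rewrite !ffunE => -[[lt01 lt12 lt23 lt34] def_f [e0 e1 e2 e3 e4]].
have injv := bij_inj bijv.
have ext i : v i \in e -> i != i1 -> i != i3 ->
    v i |: [set v i1; v i3] \in pair_extension E f.
  move=> ie ne1 ne3; apply/pair_extensionP; exists e, (v i).
  by rewrite def_f !inE !(inj_eq injv) negb_or ne1 ne3.
(* The color of [f e] is the first entry for the positions [i1], [i3], [i4], the second for [i0],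
   [i1], [i3] and the third for [i1], [i2], [i3]. *)
apply: (Phi8_not_all_roles D_uniq).
- apply: (cPhi i1 i3 i4) => //=; first exact: ltn_trans lt23.
  rewrite setUC; apply: ext => //; rewrite -val_eqE neq_ltn ?lt34 ?orbT //.
  by rewrite (ltn_trans lt12 (ltn_trans lt23 lt34)) orbT.
- apply: (cPhi i0 i1 i3) => //=; first exact: ltn_trans lt23.
  rewrite -setUA; apply: ext => //; rewrite -val_eqE neq_ltn ?lt01 //.
  by rewrite (ltn_trans lt01 (ltn_trans lt12 lt23)).
- apply: (cPhi i1 i2 i3) => //=.
  rewrite setUAC setUC; apply: ext => //; rewrite -val_eqE neq_ltn ?lt23 //.
  by rewrite lt12 orbT.
Qed.
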